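(* Let $0<\beta<\gamma<1$, let $\theta=1-\beta/\gamma$, and let $E\subset[1,2]$ be the set $E=\bigcup_{k\ge1}E_k$ constructed from $\beta,\gamma$ as described in the context. Then $$\dim_A E=\gamma,\qquad \dim_{A,\theta}E=\gamma,\qquad \dim_M E=\beta.$$ More precisely, each of the following quantities is finite and positive: (i) $\limsup_{\delta\to0}\delta^\beta N(E,\delta)$, (ii) $\liminf_{\delta\to0}\delta^\beta N(E,\delta)$, (iii) $\limsup_{\delta\to0}\ \sup_{|I|=\delta^\theta}\big(\tfrac{\delta}{|I|}\big)^\gamma N(E\cap I,\delta)$, (iv) $\liminf_{\delta\to0}\ \sup_{|I|=\delta^\theta}\big(\tfrac{\delta}{|I|}\big)^\gamma N(E\cap I,\delta)$, (v) $\limsup_{\delta\to0}\ \sup_{\delta\le|I|}\big(\tfrac{\delta}{|I|}\big)^\gamma N(E\cap I,\delta)$, (vi) $\liminf_{\delta\to0}\ \sup_{\delta\le|I|}\big(\tfrac{\delta}{|I|}\big)^\gamma N(E\cap I,\delta)$, where the inner suprema are over intervals $I\subset[1,2]$ with the indicated length.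
   Context: Covering numbers and dimensions. For $E\subset\mathbb R$ and $\delta>0$, $N(E,\delta)$ is the minimal number of compact intervals of length $\delta$ needed to cover $E$. The upper Minkowski dimension $\dim_M E$ is the smallest $\beta$ such that for every $\varepsilon>0$ there is $C(\varepsilon)$ with $N(E,\delta)\le C(\varepsilon)\delta^{-\beta-\varepsilon}$ for all $\delta<1$. The upper Assouad dimension $\dim_A E$ is the smallest $\gamma$ such that there exist $\delta_0>0$ and constants $C_\varepsilon$ (for all $\varepsilon>0$) with $N(E\cap I,\delta)\le C_\varepsilon(\delta/|I|)^{-\gamma-\varepsilon}$ for all $\delta\in(0,\delta_0)$ and all intervals $I$ of length $|I|\in(\delta,\delta_0)$. For $0\le\theta<1$, $\dim_{A,\theta}E$ is the smallest number $\gamma(\theta)$ such that there exist $\delta_0>0$ and constants $C_\varepsilon$ (for all $\varepsilon>0$) with $N(E\cap I,\delta)\le C_\varepsilon(\delta/|I|)^{-\gamma(\theta)-\varepsilon}$ for all $\delta\in(0,\delta_0)$ and all intervals $I$ of length $|I|=\delta^\theta$. Construction of $E$. Put $\lambda=2^{-1/\beta}$ and $\mu=2^{-1/\gamma}$, so $\lambda<\mu<1/2$. For a compact interval $[a,b]$, define $C^\mu_0([a,b])=[a,b]$, and obtain the stage-$k$ intervals from the stage-$(k-1)$ intervals by replacing each interval of length $\ell$ by its two compact subintervals of length $\mu\ell$, one containing its left endpoint and the other containing its right endpoint; thus at stage $k$ there are $2^k$ intervals of length $\mu^k(b-a)$, and $C^\mu_k([a,b])$ denotes their union. Let $\mathrm{bd}(C^\mu_k([a,b]))$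 be the set of boundary points (endpoints) of these $2^k$ intervals. For $k\ge1$ let $J_k=[1+\lambda^{k+1},1+\lambda^k]$, let $\theta=1-\beta/\gamma\in(0,1)$, and let $m(k)=1+\lfloor k/\theta\rfloor$. Set $E_k=\mathrm{bd}(C^\mu_{m(k)}(J_k))$ and $E=\bigcup_{k=1}^\infty E_k$. *)

(* Defs.v *)
From mathcomp Require Import all_boot all_order all_algebra.
From mathcomp Require Import all_classical all_reals all_analysis.
Set Implicit Arguments.
Unset Strict Implicit.
Unset Printing Implicit Defensive.
Import Order.TTheory GRing.Theory Num.Theory.
Import numFieldNormedType.Exports.
Local Open Scope classical_set_scope.
Local Open Scope ring_scope.

(* Extended-real valued: +oo when E has no finite cover by intervals of
   length delta. *)
Definition covering_number (R : realType) (E : set R) (delta : R) : \bar R :=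
  ereal_inf [set (n%:R)%:E | n in [set n : nat | exists c : nat -> R,
    E `<=` \bigcup_(i < n) `[c i, c i + delta]%classic]].

(* The booleans choose whether each endpoint belongs to the interval
   ([BSide true] is closed on the left and open on the right). *)
Definition itv_of_length (R : realType) (l : R) (I : set R) : Prop :=
  exists (a : R) (b1 b2 : bool),
    I = [set` Interval (BSide b1 a) (BSide b2 (a + l))].

Definition is_smallest (R : realType) (S : set R) (x : R) : Prop :=
  S x /\ lbound S x.

(* The dimensions are rendered as relations "x is the dimension of E":
   the smallest real number with the stated property, when it exists, is
   unique. *)
Definition is_Minkowski_dim (R : realType) (E : set R) : R -> Prop :=
  is_smallest [set b : R | forall eps : R, 0 < eps -> exists C : R,
    forall delta : R, 0 < delta -> delta < 1 ->
      (covering_number E delta <= (C * delta `^ (- b - eps))%:E)%E].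

Definition is_Assouad_dim (R : realType) (E : set R) : R -> Prop :=
  is_smallest [set g : R | exists2 delta0 : R, 0 < delta0 &
    forall eps : R, 0 < eps -> exists C : R,
    forall (delta l : R) (I : set R),
      0 < delta -> delta < delta0 -> delta < l -> l < delta0 ->
      itv_of_length l I ->
      (covering_number (E `&` I) delta
         <= (C * (delta / l) `^ (- g - eps))%:E)%E].

Definition is_Assouad_spectrum (R : realType) (theta : R) (E : set R) :
    R -> Prop :=
  is_smallest [set g : R | exists2 delta0 : R, 0 < delta0 &
    forall eps : R, 0 < eps -> exists C : R,
    forall (delta : R) (I : set R),
      0 < delta -> delta < delta0 ->
      itv_of_length (delta `^ theta) I ->
      (covering_number (E `&` I) delta
         <= (C * (delta / delta `^ theta) `^ (- g - eps))%:E)%E].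

Definition cantor_step (R : realType) (mu : R) (J : R * R) : seq (R * R) :=
  [:: (J.1, J.1 + mu * (J.2 - J.1)); (J.2 - mu * (J.2 - J.1), J.2)].

(* The 2 ^ k stage-k intervals, each given by its pair of endpoints. *)
Fixpoint cantor_itvs (R : realType) (mu : R) (k : nat) (J : R * R) :
    seq (R * R) :=
  if k is k'.+1 then flatten (map (cantor_step mu) (cantor_itvs mu k' J))
  else [:: J].

Definition cantor_bd (R : realType) (mu : R) (k : nat) (J : R * R) : set R :=
  [set x | exists2 K, K \in cantor_itvs mu k J & x = K.1 \/ x = K.2].

Section Construction.
Variables (R : realType) (beta gamma : R).

Definition lam : R := 2 `^ (- beta^-1).
Definition mu : R := 2 `^ (- gamma^-1).
Definition theta : R := 1 - beta / gamma.

Definition J (k : nat) : R * R := (1 + lam ^+ k.+1, 1 + lam ^+ k).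

Definition m (k : nat) : nat := (1 + Num.truncn (k%:R / theta))%N.

Definition Ek (k : nat) : set R := cantor_bd mu (m k) (J k).

Definition E : set R := \bigcup_(k in [set k : nat | (1 <= k)%N]) Ek k.

End Construction.

(* The supremum of (delta / |I|) ^ gamma * N(E `&` I, delta) over the
   intervals I `<=` [1, 2] whose length lies in L. *)
Definition sup_local_count (R : realType) (E : set R) (gamma : R) (L : set R)
    (delta : R) : \bar R :=
  ereal_sup [set y | exists (l : R) (I : set R),
    [/\ L l, itv_of_length l I, I `<=` `[1, 2]%classic &
        y = (((delta / l) `^ gamma)%:E * covering_number (E `&` I) delta)%E]].

Definition finite_positive (R : realType) (x : \bar R) : Prop :=
  (0 < x)%E /\ (x < +oo)%E.

(* Main.v *)
(* Put N = covering number, g = gamma. Each step of the Cantor construction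
   multiplies lengths by mu and (length / d) ^ g by mu ^ g = 1 / 2 while
   doubling the number of intervals, so induction from the outermost interval K
   inwards gives N(bd, d) ~ min (2 ^ k, (|K| / d) ^ g) at stage k, and
   N(bd `&` I, d) <= C (|I| / d) ^ g as long as d <= |I|.
   For E, the pieces contained in [1, 1 + l] contribute at most
   4 (l / d) ^ g, since lam ^ g <= 1 / 2 makes the sum over the pieces
   geometric; an interval of length l meets at most two of the other pieces.
   The index k with lam ^ k ~ d ^ theta is critical: there
   2 ^ m(k) ~ (d ^ theta / d) ^ g = d ^ (- beta). The larger pieces have
   O(2 ^ m(k)) points altogether, whence N(E, d) = O(d ^ (- beta)), and the
   single piece Ek k, which lies in [1, 1 + d ^ theta], provides the matching
   lower bound for all six quantities and all three dimensions. *)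
Require Import Defs.
From mathcomp Require Import all_boot all_order all_algebra.
From mathcomp Require Import all_classical all_reals all_analysis.
From mathcomp Require Import lra.
Set Implicit Arguments.
Unset Strict Implicit.
Unset Printing Implicit Defensive.
Import Order.TTheory GRing.Theory Num.Theory.
Import numFieldNormedType.Exports.
Local Open Scope classical_set_scope.
Local Open Scope ring_scope.

(** * Finite coverings by intervals of a fixed length *)

Section Coverings.
Variables (R : realType) (d : R).
Implicit Types (s : seq R) (A B : set R) (x y : R).

(** A cover is a list of left endpoints, so that unions become concatenation and separation becomes
    filtering. *)
Definition covers s A :=
  forall x, A x -> exists2 c, c \in s & c <= x <= c + d.

Definition coverable A y := exists2 s, covers s A & (size s)%:R <= y.

Lemma covers_sub s A B : A `<=` B -> covers s B -> covers s A.
Proof. by move=> AB sB x /AB /sB. Qed.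

Lemma coverable_sub A B y : A `<=` B -> coverable B y -> coverable A y.
Proof. by move=> AB [s /(covers_sub AB) sA sy]; exists s. Qed.

Lemma coverable_le A x y : coverable A x -> x <= y -> coverable A y.
Proof. by move=> [s sA sx] xy; exists s => //; exact: le_trans xy. Qed.

Lemma coverableU A B x y :
  coverable A x -> coverable B y -> coverable (A `|` B) (x + y).
Proof.
move=> [s sA sx] [t tB ty]; exists (s ++ t); last first.
  by rewrite size_cat natrD lerD.
by move=> z [/sA|/tB] [c cs cz]; exists c; rewrite // mem_cat cs ?orbT.
Qed.

Lemma coverable_itv A a : A `<=` `[a, a + d] -> coverable A 1.
Proof.
move=> Aa; exists [:: a] => // x /Aa /=; rewrite in_itv /= => ax.
by exists a; rewrite ?mem_head.
Qed.

Lemma coverable_set2 A a b : 0 <= d -> A `<=` [set a; b] -> coverable A 2.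
Proof.
move=> d0 Aab; exists [:: a; b] => // x /Aab [] -> /=.
  by exists a; rewrite ?mem_head // lexx lerDl.
by exists b; rewrite ?inE ?eqxx ?orbT // lexx lerDl.
Qed.

Lemma covers_size_ge1 s A : A !=set0 -> covers s A -> 1 <= (size s)%:R :> R.
Proof.
by move=> [x Ax] /(_ x Ax) [c cs _]; rewrite ler1n; case: s cs.
Qed.

(** An interval starting at or below [a] ends before [b] and so misses [B]; one starting beyond [a]
    misses [A]. Sorting the list by the test [c <= a] therefore loses nothing. *)
Lemma covers_split s A B a b :
  (forall x, A x -> x <= a) -> (forall x, B x -> b <= x) -> a + d < b ->
  covers s (A `|` B) ->
  exists s1 s2, [/\ covers s1 A, covers s2 B & size s = (size s1 + size s2)%N].
Proof.
move=> Aa Bb ab sAB.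
exists [seq c <- s | c <= a], [seq c <- s | ~~ (c <= a)].
split.
- move=> x Ax; have [|c cs /andP[cx xc]] := sAB x; first by left.
  by exists c; rewrite ?cx // mem_filter cs (le_trans cx) ?Aa.
- move=> x Bx; have [|c cs /andP[cx xc]] := sAB x; first by right.
  exists c; rewrite ?cx // mem_filter cs /= -ltNge andbT.
  by have := Bb x Bx; lra.
- by rewrite !size_filter count_predC.
Qed.

Lemma covering_number_le A y : coverable A y -> (covering_number A d <= y%:E)%E.
Proof.
move=> [s sA sy]; apply: (@le_trans _ _ (size s)%:R%:E); last by rewrite lee_fin.
apply: ereal_inf_lbound; exists (size s) => //=; exists (nth 0 s) => x /sA.
move=> [c cs cx]; exists (index c s); first by rewrite /= index_mem.
by rewrite /= nth_index // in_itv.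
Qed.

Lemma covering_number_ge A y :
  (forall s, covers s A -> y <= (size s)%:R) -> (y%:E <= covering_number A d)%E.
Proof.
move=> yA; apply: le_ereal_inf_tmp => _ [n [c Ac] <-]; rewrite lee_fin.
have := yA (mkseq c n); rewrite size_mkseq; apply => x /Ac [i /= ilt].
rewrite in_itv /= => cx; exists (c i) => //.
by apply/mapP; exists i; rewrite ?mem_iota.
Qed.

End Coverings.

(** * Covering counts for the endpoints of one Cantor stage *)

Section CantorIntervals.
Variables (R : realType) (mu gamma : R).
Hypotheses (mu_gt0 : 0 < mu) (mu2_lt1 : 2 * mu < 1).
Hypotheses (gamma_ge0 : 0 <= gamma) (mu_powR : mu `^ gamma = 2^-1).
Implicit Types (K : R * R) (k : nat) (d l : R) (A : set R).

Definition cantor_left K := (K.1, K.1 + mu * (K.2 - K.1)).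
Definition cantor_right K := (K.2 - mu * (K.2 - K.1), K.2).

(** The recursion in [cantor_itvs] subdivides the innermost intervals; here the outermost step is
    peeled off, so that inductions can pass to the two children of [K]. *)
Lemma cantor_itvsS k K : cantor_itvs mu k.+1 K =
  cantor_itvs mu k (cantor_left K) ++ cantor_itvs mu k (cantor_right K).
Proof.
elim: k => [//|k IH].
by rewrite -[LHS]/(flatten (map (cantor_step mu) (cantor_itvs mu k.+1 K)))
  IH map_cat flatten_cat.
Qed.

Lemma cantor_bd0 K : cantor_bd mu 0 K = [set K.1; K.2].
Proof.
apply/seteqP; split=> [x [L]|x /= xK]; first by rewrite inE => /eqP ->.
by exists K; rewrite ?mem_head.
Qed.

Lemma cantor_bdS k K : cantor_bd mu k.+1 K =
  cantor_bd mu k (cantor_left K) `|` cantor_bd mu k (cantor_right K).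
Proof.
rewrite /cantor_bd cantor_itvsS; apply/seteqP; split=> x /=.
  by move=> [L]; rewrite mem_cat => /orP[] ? ?; [left|right]; exists L.
by move=> [] [L LK ?]; exists L; rewrite ?mem_cat ?LK ?orbT.
Qed.

Lemma cantor_bd_sub k K : K.1 <= K.2 -> cantor_bd mu k K `<=` `[K.1, K.2].
Proof.
have [mu0 mu1] := (mu_gt0, mu2_lt1).
elim: k K => [|k IH] K K12.
  by rewrite cantor_bd0 => x /= [] ->; rewrite in_itv /= lexx K12.
have h0 : 0 <= mu * (K.2 - K.1) by apply: mulr_ge0; [exact: ltW|rewrite subr_ge0].
have h1 : mu * (K.2 - K.1) <= K.2 - K.1 by rewrite ler_piMl; lra.
rewrite cantor_bdS => x [] /IH /=; rewrite !in_itv /= => xK.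
  by have /andP[? ?] := xK ltac:(lra); apply/andP; split; lra.
by have /andP[? ?] := xK ltac:(lra); apply/andP; split; lra.
Qed.

Lemma cantor_bd_neq0 k K : cantor_bd mu k K !=set0.
Proof.
elim: k K => [|k IH] K; first by rewrite cantor_bd0; exists K.1; left.
by rewrite cantor_bdS; have [x ?] := IH (cantor_left K); exists x; left.
Qed.

Lemma powR_mulmu x : 0 <= x -> (mu * x) `^ gamma = 2^-1 * x `^ gamma.
Proof. by move=> x0; rewrite powRM ?(ltW mu_gt0) // mu_powR. Qed.

Lemma powR_ge1 x : 1 <= x -> 1 <= x `^ gamma.
Proof.
by move=> x1; have := @ler_powR _ _ x1 _ _ gamma_ge0; rewrite powRr0.
Qed.

Lemma powR_le1 x : 0 <= x <= 1 -> x `^ gamma <= 1.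
Proof.
move=> /andP[x0 x1].
by have := ge0_ler_powR gamma_ge0 x0 ler01 x1; rewrite powR1.
Qed.

Lemma cantor_bd_coverable_card k K d :
  0 <= d -> coverable d (cantor_bd mu k K) (2 ^+ k.+1).
Proof.
move=> d0; elim: k K => [|k IH] K.
  by rewrite cantor_bd0 expr1; exact: coverable_set2 d0 (@subset_refl _ _).
by rewrite cantor_bdS exprS mulr2n mulrDl mul1r; exact: coverableU.
Qed.

(** When [K] is longer than [d], the power is at least [1] and the bound of each child is half that
    of [K]. The factor [2] pays for the two endpoints at stage [0]. *)
Lemma cantor_bd_coverable k K d : 0 < d -> K.1 <= K.2 ->
  coverable d (cantor_bd mu k K)
    (Num.max 1 (2 * ((K.2 - K.1) / d) `^ gamma)).
Proof.
have [mu0 mu1] := (mu_gt0, mu2_lt1).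
(* Both cases of the induction begin with the same split: if [K.2 - K.1 <= d], a single interval is
   enough. *)
move=> d0; elim: k K => [|k IH] K K12;
  (have [dK|Kd] := ltP d (K.2 - K.1); last by
    (apply: (coverable_le (x := 1)); last by rewrite le_max lexx);
    apply: (@coverable_itv _ _ _ K.1) => x /(cantor_bd_sub K12) /=;
    rewrite !in_itv /= => /andP[? ?]; apply/andP; split; lra);
  (have L1 : 1 <= ((K.2 - K.1) / d) `^ gamma
    by apply: powR_ge1; rewrite ler_pdivlMr // mul1r ltW).
  rewrite cantor_bd0; apply: coverable_le (coverable_set2 (ltW d0) (@subset_refl _ _)) _.
  by rewrite le_max; lra.
(* For a child, of length [c], the maximum collapses: its second term is
   [((K.2 - K.1) / d) ^ gamma], which is at least [1] by [L1]. *)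
have half : forall c : R, 0 <= K.2 - K.1 ->
    c = mu * (K.2 - K.1) -> Num.max 1 (2 * (c / d) `^ gamma) =
    ((K.2 - K.1) / d) `^ gamma.
  move=> c K0 ->; rewrite -mulrA powR_mulmu; last by rewrite divr_ge0 // ltW.
  by rewrite mulrA divff // mul1r; apply/max_idPr.
have h0 : 0 <= mu * (K.2 - K.1) by apply: mulr_ge0; [exact: ltW|rewrite subr_ge0].
rewrite cantor_bdS.
apply: coverable_le
  (coverableU (IH (cantor_left K) _) (IH (cantor_right K) _)) _ => /=; try lra.
rewrite (half (K.1 + mu * (K.2 - K.1) - K.1)) ?(half (K.2 - (K.2 - _))); try lra.
by rewrite le_max; lra.
Qed.

(** The factor [1 - 2 * mu] measures the gap between the two children relative to [K]. If the gap
    exceeds [d], every cover splits into covers of the children; otherwise the power is at most [1]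
    and nonemptiness suffices. *)
Lemma cantor_bd_covers_size k K d s : 0 < d -> K.1 <= K.2 ->
  covers d s (cantor_bd mu k K) ->
  Num.min (2 ^+ k) (((1 - 2 * mu) * (K.2 - K.1) / d) `^ gamma) <= (size s)%:R.
Proof.
have [mu0 mu1] := (mu_gt0, mu2_lt1).
move=> d0; elim: k K s => [|k IH] K s K12 sK.
  rewrite ge_min expr0; apply/orP; left.
  exact: covers_size_ge1 (cantor_bd_neq0 _ _) sK.
have [dK|Kd] := leP ((1 - 2 * mu) * (K.2 - K.1)) d.
  rewrite ge_min; apply/orP; right.
  apply: le_trans (covers_size_ge1 (cantor_bd_neq0 _ _) sK).
  apply: powR_le1; rewrite ler_pdivrMr // mul1r dK andbT divr_ge0 //.
  - by apply: mulr_ge0; lra.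
  - exact: ltW.
have h0 : 0 <= mu * (K.2 - K.1) by apply: mulr_ge0; [exact: ltW|rewrite subr_ge0].
move: sK; rewrite cantor_bdS => sK.
have [|||s1 [s2 [/IH h1 /IH h2 ->]]] := @covers_split _ _ _ _ _
  (K.1 + mu * (K.2 - K.1)) (K.2 - mu * (K.2 - K.1)) _ _ _ sK.
- by move=> x /cantor_bd_sub /=; rewrite in_itv /= => /(_ ltac:(lra)) /andP[].
- by move=> x /cantor_bd_sub /=; rewrite in_itv /= => /(_ ltac:(lra)) /andP[].
- lra.
move: {IH} (h1 ltac:(move=> /=; lra)) (h2 ltac:(move=> /=; lra)) => /=.
rewrite (_ : K.2 - (K.2 - mu * (K.2 - K.1)) = mu * (K.2 - K.1)); last lra.
rewrite (_ : K.1 + mu * (K.2 - K.1) - K.1 = mu * (K.2 - K.1)); last lra.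
rewrite [(1 - 2 * mu) * _]mulrCA -[mu * _ / d]mulrA powR_mulmu; last first.
  by rewrite divr_ge0 ?(ltW d0) // mulr_ge0; lra.
(* Each child needs at least the minimum of [2 ^ k] and [X / 2]; the sum of the two doubles both
   terms. *)
set X := (_ / d) `^ gamma; rewrite exprS natrD.
by case: (leP (2 ^+ k) (2^-1 * X)) => _ ? ?; rewrite ge_min; apply/orP;
  [left|right]; lra.
Qed.

(** As long as the gap between the children exceeds [l], the set [A] lies in one child and the
    induction descends there. It stops at stage [0], or once [K] has length at most
    [l / (1 - 2 * mu)], where the bound for all of [K] applies. *)
Lemma cantor_bd_local_coverable k K d l A :
  0 < d -> d <= l -> K.1 <= K.2 -> A `<=` cantor_bd mu k K ->
  (forall x y, A x -> A y -> y - x <= l) ->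
  coverable d A (2 * (l / d / (1 - 2 * mu)) `^ gamma).
Proof.
have [mu0 mu1] := (mu_gt0, mu2_lt1).
move=> d0 dl + + Al; have l1 : 1 <= (l / d / (1 - 2 * mu)) `^ gamma.
  apply: powR_ge1; rewrite ler_pdivlMr ?mul1r; last lra.
  by rewrite ler_pdivlMr //; nra.
elim: k K => [|k IH] K K12 AK.
  apply: (coverable_le (x := 2)); last lra.
  by apply: (coverable_set2 (a := K.1) (b := K.2) (ltW d0)); rewrite -cantor_bd0.
have h0 : 0 <= mu * (K.2 - K.1) by apply: mulr_ge0; [exact: ltW|rewrite subr_ge0].
have [lK|Kl] := ltP l ((1 - 2 * mu) * (K.2 - K.1)); last first.
  apply: coverable_le (coverable_sub AK (cantor_bd_coverable _ d0 K12)) _.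
  rewrite ge_max; apply/andP; split; first lra.
  rewrite ler_pM2l // ge0_ler_powR // ?nnegrE ?divr_ge0 //; try lra.
  rewrite [_ / _ / _]mulrAC ler_pM2r ?invr_gt0 // ler_pdivlMr; lra.
move: AK; rewrite cantor_bdS => AK.
(* One point of [A] in the left child excludes the right child, which is more than [l] away. *)
have [[x [Ax xK]]|nA] := pselect (exists x, A x /\ cantor_bd mu k (cantor_left K) x).
  apply: (IH (cantor_left K)) => /=; first lra.
  move=> y Ay; case: (AK y Ay) => // yK.
  have := Al x y Ax Ay.
  move: xK yK => /cantor_bd_sub /= /(_ ltac:(lra)) + /cantor_bd_sub /= /(_ ltac:(lra)).
  by rewrite !in_itv /= => /andP[? ?] /andP[? ?]; lra.
apply: (IH (cantor_right K)) => /=; first lra.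
by move=> y Ay; case: (AK y Ay) => // yK; case: nA; exists y.
Qed.

End CantorIntervals.

(** * Minimal indices and monotonicity of real powers *)

Lemma ex_minimal (P : nat -> Prop) : (exists n, P n) ->
  exists n, P n /\ forall k, P k -> (n <= k)%N.
Proof.
move=> [n Pn]; have exP : exists n, `[< P n >] by exists n; apply/asboolP.
case: (ex_minnP exP) => k /asboolP Pk kmin; exists k; split=> // j Pj.
by apply: kmin; apply/asboolP.
Qed.

Lemma le_powRN (R : realType) (x y s : R) :
  0 < x -> x <= y -> 0 <= s -> y `^ (- s) <= x `^ (- s).
Proof.
move=> x0 xy s0; have y0 : 0 < y by exact: lt_le_trans xy.
rewrite !powRN lef_pV2 ?posrE ?powR_gt0 //.
by rewrite ge0_ler_powR // nnegrE ltW.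
Qed.

Lemma ltr_powR2 (R : realType) (x y : R) : x < y -> (2 : R) `^ x < 2 `^ y.
Proof.
by move=> xy; rewrite /powR pnatr_eq0 /= ltr_expR ltr_pM2r // ln_gt0 // ltr1n.
Qed.

(** * Geometry and coverings of the set [E] *)

Section Construction.
Variables (R : realType) (beta gamma : R).
Hypotheses (beta_gt0 : 0 < beta) (beta_lt_gamma : beta < gamma).
Hypothesis gamma_lt1 : gamma < 1.
Implicit Types (A : set R) (d l x y : R) (j k : nat) (s : seq R).

Local Notation lam := (Defs.lam beta).
Local Notation mu := (Defs.mu gamma).
Local Notation theta := (Defs.theta beta gamma).
Local Notation J := (Defs.J beta).
Local Notation m := (Defs.m beta gamma).
Local Notation Ek := (Defs.Ek beta gamma).
Local Notation E := (Defs.E beta gamma).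

Let gamma_gt0 : 0 < gamma. Proof. exact: lt_trans beta_lt_gamma. Qed.

Lemma powR2_invN_lt (a : R) : 0 < a < 1 -> 2 * (2 `^ (- a^-1)) < 1.
Proof.
move=> /andP[a0 a1]; have : 2 `^ (- a^-1) < (2 : R) `^ (-1).
  by apply: ltr_powR2; rewrite ltrN2 invf_gt1.
by rewrite powR_inv1 //; lra.
Qed.

Lemma powR2_invNK (a : R) : 0 < a -> (2 `^ (- a^-1)) `^ a = 2^-1.
Proof.
by move=> a0; rewrite -powRrM mulNr mulVf ?gt_eqF // powR_inv1.
Qed.

Lemma lam_gt0 : 0 < lam. Proof. exact: powR_gt0. Qed.
Lemma lam2_lt1 : 2 * lam < 1.
Proof. by apply: powR2_invN_lt; rewrite beta_gt0 (lt_trans beta_lt_gamma). Qed.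
Lemma mu_gt0 : 0 < mu. Proof. exact: powR_gt0. Qed.
Lemma mu2_lt1 : 2 * mu < 1.
Proof. by apply: powR2_invN_lt; rewrite gamma_gt0. Qed.
Lemma mu_powR_gamma : mu `^ gamma = 2^-1. Proof. exact: powR2_invNK. Qed.

(** Since [lam < 1] and [beta < gamma], this follows from [lam ^ beta = 1 / 2]. *)
Lemma lam_powR_gamma : lam `^ gamma <= 2^-1.
Proof.
rewrite -(powR2_invNK beta_gt0); apply: ger_powR; last exact: ltW.
by have [? ?] := (lam_gt0, lam2_lt1); rewrite lam_gt0 /=; lra.
Qed.

Lemma theta_gt0 : 0 < theta.
Proof. by rewrite subr_gt0 ltr_pdivrMr // mul1r. Qed.

Lemma theta_lt1 : theta < 1.
Proof. by rewrite /theta ltrBlDr ltrDl divr_gt0. Qed.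

Lemma lamX_gt0 k : 0 < lam ^+ k. Proof. by rewrite exprn_gt0 // lam_gt0. Qed.

Lemma lamX_ltS k : 2 * lam ^+ k.+1 < lam ^+ k.
Proof.
have [? ?] := (lamX_gt0 k, lam2_lt1).
by rewrite exprS mulrA gtr_pMl.
Qed.

Lemma lamX_le j k : (j <= k)%N -> lam ^+ k <= lam ^+ j.
Proof.
move=> jk; apply: ler_wiXn2l jk; first exact: ltW lam_gt0.
by have [? ?] := (lam_gt0, lam2_lt1); lra.
Qed.

(** Locates the scale [x] among the pieces: exactly those of index at least [k] have outer endpoint
    at most [1 + x]. *)
Lemma lam_scale x : 0 < x ->
  exists k, lam ^+ k <= x /\ forall j, lam ^+ j <= x -> (k <= j)%N.
Proof.
move=> x0; apply: ex_minimal.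
have /cvg_expr /cvgrPdist_lt /(_ x x0) [n _ /(_ n (leqnn n))] : `|lam| < 1.
  by have [? ?] := (lam_gt0, lam2_lt1); rewrite gtr0_norm //; lra.
by rewrite sub0r normrN gtr0_norm ?lamX_gt0 // => /ltW; exists n.
Qed.

Lemma J_le k : (J k).1 <= (J k).2.
Proof. by have [? ?] := (lamX_ltS k, lamX_gt0 k.+1); rewrite /=; lra. Qed.

Lemma Ek_sub k : Ek k `<=` `[1 + lam ^+ k.+1, 1 + lam ^+ k].
Proof. exact: (cantor_bd_sub mu_gt0 mu2_lt1 (J_le k)). Qed.

Lemma E_sub : E `<=` `[1, 2].
Proof.
move=> x [k _ /Ek_sub] /=; rewrite !in_itv /= => /andP[? ?].
have := lamX_le (leq0n k); rewrite expr0 => ?.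
by have := lamX_gt0 k.+1 => ?; apply/andP; split; lra.
Qed.

(** For [k = 0] this also contains [Ek 0], which is not among the pieces of [E]; tails are only ever
    bounded from above. *)
Definition E_tail k : set R := \bigcup_(j in [set j | (k <= j)%N]) Ek j.

Definition E_head k : set R := \bigcup_(j in [set j | (1 <= j < k)%N]) Ek j.

Lemma E_tail_sub k : E_tail k `<=` `[1, 1 + lam ^+ k].
Proof.
move=> x [j /= /lamX_le kj /Ek_sub] /=; rewrite !in_itv /= => /andP[? ?].
by have := lamX_gt0 j.+1 => ?; apply/andP; split; lra.
Qed.

(** The constant [4] is self-reproducing: the first piece costs [2] times the power, and the
    remaining tail at most [4] times half of it, as [lam ^ gamma <= 1 / 2]. *)
Lemma E_tail_coverable d k : 0 < d ->
  coverable d (E_tail k) (Num.max 1 (4 * (lam ^+ k / d) `^ gamma)).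
Proof.
move=> d0; have [n [+ _]] := lam_scale d0.
(* The induction runs over the number [n] of pieces to remove before the tail fits in one interval,
   with invariant [lam ^ (k + n) <= d]. *)
move=> /(le_trans (lamX_le (leq_addl k n))).
elim: n k => [|n IH] k kd; (have [dk|{}kd] := ltP d (lam ^+ k); last by
  (apply: (coverable_le (x := 1)); last by rewrite le_max lexx);
  apply: (@coverable_itv _ _ _ 1) => x /E_tail_sub /=;
  rewrite !in_itv /= => /andP[? ?]; apply/andP; split; lra).
  by move: kd; rewrite addn0 leNgt dk.
have x1 : 1 <= (lam ^+ k / d) `^ gamma.
  by apply: powR_ge1 (ltW gamma_gt0) _ _; rewrite ler_pdivlMr // mul1r ltW.
have tk : E_tail k `<=` Ek k `|` E_tail k.+1.
  move=> x [j /= ]; rewrite leq_eqVlt => /orP[/eqP <-|kj] xj; first by left.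
  by right; exists j.
have Jk : coverable d (Ek k) _ := cantor_bd_coverable mu_gt0 mu2_lt1
  (ltW gamma_gt0) mu_powR_gamma (m k) d0 (J_le k).
have Tk : coverable d (E_tail k.+1) _ := IH k.+1 (le_trans _ kd).
apply: coverable_le (coverable_sub tk (coverableU Jk (Tk _))) _.
  by rewrite addSnnS.
have h1 : ((J k).2 - (J k).1) / d <= lam ^+ k / d.
  by rewrite ler_pM2r ?invr_gt0 //=; have := lamX_gt0 k.+1; lra.
have h2 : (((J k).2 - (J k).1) / d) `^ gamma <= (lam ^+ k / d) `^ gamma.
  apply: ge0_ler_powR h1; rewrite ?(ltW gamma_gt0) // nnegrE divr_ge0 ?(ltW d0) //.
    by rewrite subr_ge0 J_le.
  exact: ltW (lamX_gt0 k).
have h3 : (lam ^+ k.+1 / d) `^ gamma <= 2^-1 * (lam ^+ k / d) `^ gamma.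
  rewrite exprS -mulrA powRM ?(ltW lam_gt0) ?divr_ge0 ?(ltW d0) //; last first.
    exact: ltW (lamX_gt0 k).
  by rewrite ler_wpM2r ?powR_ge0 // lam_powR_gamma.
have -> : 4 * (lam ^+ k / d) `^ gamma =
    2 * (lam ^+ k / d) `^ gamma + 2 * (lam ^+ k / d) `^ gamma by lra.
rewrite le_max; apply/orP; right; apply: lerD.
  by rewrite ge_max; apply/andP; split; lra.
by rewrite ge_max; apply/andP; split; lra.
Qed.

(** The first [4] comes from the tail, the second term from two pieces costing
    [2 * (1 / (1 - 2 * mu)) ^ gamma] each. *)
Definition local_const : R := 4 + 4 * ((1 - 2 * mu)^-1) `^ gamma.

(* If [j + 2 <= i], the distance between [Ek j] and [Ek i] is at least
   [lam ^ j.+1 - lam ^ i > lam ^ i], so a set of diameter less than [lam ^ i]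
   cannot meet both. *)
Lemma local_coverable A d l : 0 < d -> d <= l -> A `<=` E ->
  (forall x y, A x -> A y -> y - x <= l) ->
  coverable d A (local_const * (l / d) `^ gamma).
Proof.
move=> d0 dl AE Al; have l0 : 0 < l by exact: lt_le_trans dl.
have [k [kl kmin]] := lam_scale l0.
(* [P] selects the pieces of scale larger than [l] that meet [A]; they have at most two indices, and
   these are consecutive. *)
pose P j := l < lam ^+ j /\ exists2 x, A x & Ek j x.
have [j0 Pmin] : exists j0, forall j, P j -> j = j0 \/ j = j0.+1.
  have [/ex_minimal [j0 [Pj0 j0min]]|nP] := pselect (exists j, P j); last first.
    by exists 0%N => j Pj; case: nP; exists j.
  exists j0 => j Pj; have := j0min j Pj.
  rewrite leq_eqVlt => /orP[/eqP|]; first by left.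
  rewrite leq_eqVlt => /orP[/eqP|j0j]; first by right.
  have [[lj [x Ax /Ek_sub xj]] [_ [y Ay /Ek_sub yj]]] := (Pj, Pj0).
  move: xj yj; rewrite /= !in_itv /= => /andP[_ xj] /andP[yj _].
  have yx := Al x y Ax Ay.
  by have [? ?] := (lamX_le j0j, lamX_ltS j0.+1); exfalso; lra.
have Asub : A `<=` ((A `&` Ek j0) `|` (A `&` Ek j0.+1)) `|` E_tail k.
  move=> x Ax; have [j _ xj] := AE x Ax.
  (* Pieces of scale at most [l] belong to the tail from [k], by minimality of [k]. *)
  have [/kmin kj|lj] := leP (lam ^+ j) l; first by right; exists j.
  left; have [|<-|<-] := Pmin j; first by split => //; exists x.
    by left.
  by right.
have Aj j : coverable d (A `&` Ek j) _ :=
  cantor_bd_local_coverable mu_gt0 mu2_lt1 (ltW gamma_gt0) mu_powR_gamma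
    d0 dl (J_le j) (@subIsetr _ A (Ek j))
    (fun x y Ax Ay => Al x y Ax.1 Ay.1).
apply: coverable_le (coverable_sub Asub
  (coverableU (coverableU (Aj j0) (Aj j0.+1)) (E_tail_coverable k d0))) _.
have [? ?] := (mu_gt0, mu2_lt1).
have ld0 : 0 <= l / d by rewrite divr_ge0 ?ltW.
have x1 : 1 <= (l / d) `^ gamma.
  by apply: powR_ge1 (ltW gamma_gt0) _ _; rewrite ler_pdivlMr // mul1r.
have h1 : (lam ^+ k / d) `^ gamma <= (l / d) `^ gamma.
  apply: ge0_ler_powR; rewrite ?(ltW gamma_gt0) ?nnegrE //.
    by rewrite divr_ge0 ?(ltW d0) // (ltW (lamX_gt0 k)).
  by rewrite ler_pM2r ?invr_gt0.
rewrite powRM // ?invr_ge0; last by lra.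
have -> : local_const * (l / d) `^ gamma =
  (2 * ((l / d) `^ gamma * ((1 - 2 * mu)^-1) `^ gamma) +
   2 * ((l / d) `^ gamma * ((1 - 2 * mu)^-1) `^ gamma)) + 4 * (l / d) `^ gamma.
  by rewrite /local_const; set u := _^-1 `^ _; set v := (l / d) `^ _; lra.
by rewrite lerD2l ge_max; apply/andP; split; lra.
Qed.

(** Up to rounding in [m], the ratio of the numbers of intervals in consecutive pieces. *)
Definition growth : R := 2 `^ (theta^-1).

Lemma growth_ge2 : 2 <= growth.
Proof.
have [? ?] := (theta_gt0, theta_lt1).
have := @ler_powR R 2 _ 1 theta^-1; rewrite powRr1 //; apply.
  by rewrite ler1n.
by rewrite invf_ge1 // ltW.
Qed.

(** The exponent [m k] lies between [k / theta] and [1 + k / theta]. *)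
Lemma growthX_le k : growth ^+ k <= 2 ^+ m k <= 2 * growth ^+ k.
Proof.
rewrite -!powR_mulrn ?powR_ge0 // -powRrM.
have -> : 2 * 2 `^ (theta^-1 * k%:R) = (2 : R) `^ (1 + theta^-1 * k%:R).
  by rewrite powRD ?powRr1 // pnatr_eq0 implybT.
have kth : 0 <= k%:R / theta by rewrite divr_ge0 // ltW // theta_gt0.
have /andP[h1 h2] := truncn_itv kth.
have le12 : 1 <= 2 :> R by rewrite ler1n.
rewrite ![theta^-1 * _]mulrC; apply/andP; split; apply: ler_powR => //.
  by rewrite /m add1n ltW.
by rewrite /m natrD lerD2l.
Qed.

(** Holds because [2 = lam ^ (- beta)]; it turns counts indexed by [k] into powers of the scale
    [lam ^ k], to be compared with [d ^ theta]. *)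
Lemma growthXE k : growth ^+ k = (lam ^+ k) `^ (- (beta / theta)).
Proof.
rewrite -!powR_mulrn ?powR_ge0 // -!powRrM; congr (_ `^ _).
by rewrite mulrN !mulNr mulrN opprK mulrCA mulKf ?gt_eqF // mulrC.
Qed.

Lemma powR_thetaE d : (d `^ theta) `^ (- (beta / theta)) = d `^ (- beta).
Proof.
by rewrite -powRrM mulrN mulrCA divff ?mulr1 // gt_eqF // theta_gt0.
Qed.

(** This encodes [(1 - theta) * gamma = beta], the relation that singles out [theta]: the local
    count at length [d ^ theta] has the order of the global one. *)
Lemma powR_scaleE d : 0 < d -> (d `^ theta / d) `^ gamma = d `^ (- beta).
Proof.
move=> d0; rewrite -{2}(powRr1 (ltW d0)) -powRB; last first.
  by rewrite (gt_eqF d0) implybT.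
rewrite -powRrM; congr (_ `^ _); rewrite /theta addrAC subrr add0r mulNr.
by rewrite divfK // gt_eqF.
Qed.

(** Endpoints are covered one by one. The piece [Ek k] needs at most
    [2 ^ (m k + 1) <= 4 * growth ^ k] intervals, and the sum is geometric since [growth >= 2]. *)
Lemma E_head_coverable d k : 0 <= d -> coverable d (E_head k) (4 * growth ^+ k).
Proof.
move=> d0; elim: k => [|k IH].
  by exists [::]; [move=> x [j /=]; rewrite ltn0 andbF|rewrite mulr_ge0].
have hk : E_head k.+1 `<=` E_head k `|` Ek k.
  move=> x [j /= /andP[j1]]; rewrite ltnS leq_eqVlt => /orP[/eqP ->|jk] xj.
    by right.
  by left; exists j => //=; rewrite j1.
apply: coverable_le (coverable_sub hk
  (coverableU IH (cantor_bd_coverable_card _ _ _ d0))) _.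
have /andP[_ h1] := growthX_le k.
have : 2 * growth ^+ k <= growth * growth ^+ k.
  by rewrite ler_wpM2r ?growth_ge2 // exprn_ge0 // powR_ge0.
by rewrite (exprS _ k) (exprS _ (m k)); lra.
Qed.

Lemma theta_scale d : 0 < d -> d < 1 ->
  exists k, lam ^+ k.+1 <= d `^ theta < lam ^+ k.
Proof.
move=> d0 d1; have dth0 : 0 < d `^ theta by exact: powR_gt0.
have [[|k] [kd kmin]] := lam_scale dth0.
  (* Index [0] is impossible, since [d ^ theta < 1]. *)
  move: kd; rewrite expr0 leNgt.
  have := gt0_ltr_powR theta_gt0 _ _ d1.
  by rewrite powR1 => -> //; rewrite nnegrE // ltW.
by exists k; rewrite kd ltNge; apply/negP => /kmin; rewrite ltnn.
Qed.

Definition global_const : R := 4 * growth + 4.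

(** The set is cut at the critical index. The head costs [4 * growth * growth ^ k], bounded through
    [d ^ theta < lam ^ k]; the tail lies at scale at most [d ^ theta], which [powR_scaleE]
    converts. *)
Lemma E_coverable d : 0 < d -> d < 1 ->
  coverable d E (global_const * d `^ (- beta)).
Proof.
move=> d0 d1; have [k /andP[kd dk]] := theta_scale d0 d1.
have dth0 : 0 < d `^ theta by exact: powR_gt0.
have Esub : E `<=` E_head k.+1 `|` E_tail k.+1.
  move=> x [j /= j1 xj]; have [kj|jk] := leqP k.+1 j; first by right; exists j.
  by left; exists j => //=; rewrite j1.
apply: coverable_le (coverable_sub Esub
  (coverableU (E_head_coverable _ (ltW d0)) (E_tail_coverable _ d0))) _.
rewrite /global_const [(_ + 4) * _]mulrDl; apply: lerD.
  rewrite exprS mulrA ler_pM2l ?mulr_gt0 ?powR_gt0 //.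
  rewrite growthXE -powR_thetaE; apply: le_powRN (ltW dk) _ => //.
  by rewrite divr_ge0 ?ltW // theta_gt0.
rewrite ge_max; apply/andP; split.
  have : 1 <= d `^ (- beta).
    have := @le_powRN R d 1 beta d0 (ltW d1) (ltW beta_gt0).
    by rewrite powR1.
  by move=> ?; lra.
rewrite ler_pM2l // -powR_scaleE //; apply: ge0_ler_powR.
- exact: ltW.
- by rewrite nnegrE divr_ge0 ?(ltW d0) // (ltW (lamX_gt0 _)).
- by rewrite nnegrE divr_ge0 ?(ltW d0) // ltW.
- by rewrite ler_pM2r ?invr_gt0.
Qed.

(** Here [1 - 2 * mu] is the gap ratio of the Cantor step and [lam / 2] bounds from below the ratio
    of the length of the critical [J] to [d ^ theta]. *)
Definition lower_const : R := ((1 - 2 * mu) * (lam / 2)) `^ gamma.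

Lemma lower_const_gt0 : 0 < lower_const.
Proof.
have [? ?] := (mu2_lt1, lam_gt0).
by apply: powR_gt0; rewrite mulr_gt0 ?divr_gt0 //; lra.
Qed.

Lemma covers_size_ge d s : 0 < d -> d < 1 ->
  covers d s (E `&` `[1, 1 + d `^ theta]) ->
  lower_const * d `^ (- beta) <= (size s)%:R.
Proof.
move=> d0 d1 sE; have [k /andP[kd dk]] := theta_scale d0 d1.
have [[? ?] [? ?]] := ((mu_gt0, mu2_lt1), (lam_gt0, lam2_lt1)).
have dth0 : 0 < d `^ theta by exact: powR_gt0.
have Esub : Ek k.+1 `<=` E `&` `[1, 1 + d `^ theta].
  move=> x xk; split; first by exists k.+1.
  move: xk => /Ek_sub /=; rewrite !in_itv /= => /andP[? ?].
  by have := lamX_gt0 k.+2 => ?; apply/andP; split; lra.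
apply: le_trans (cantor_bd_covers_size mu_gt0 mu2_lt1 (ltW gamma_gt0)
  mu_powR_gamma d0 (J_le k.+1) (covers_sub Esub sE)).
(* At the critical piece both terms of the minimum have order [d ^ (- beta)]: the number of
   intervals through [growth], the power of the length through [powR_scaleE]. *)
rewrite le_min; apply/andP; split.
  have /andP[h1 _] := growthX_le k.+1; apply: le_trans h1.
  have h2 : d `^ (- beta) <= growth ^+ k.+1.
    rewrite growthXE -powR_thetaE; apply: le_powRN (lamX_gt0 _) kd _.
    by rewrite divr_ge0 ?ltW // theta_gt0.
  apply: le_trans h2; rewrite ler_piMl ?powR_ge0 //.
  by apply: powR_le1 (ltW gamma_gt0) _ _; apply/andP; split; nra.
rewrite -powR_scaleE // -powRM; last 2 first.
- by rewrite mulr_ge0 ?divr_ge0 //; lra.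
- by rewrite divr_ge0 ?ltW.
have h : lam / 2 * d `^ theta <= (J k.+1).2 - (J k.+1).1.
  have : lam * d `^ theta <= lam ^+ k.+1 by rewrite exprS ler_pM2l // ltW.
  by have := lamX_ltS k.+1; rewrite /=; lra.
apply: ge0_ler_powR; first exact: ltW.
- by rewrite nnegrE !mulr_ge0 ?invr_ge0 ?(ltW d0) ?(ltW dth0) //; lra.
- rewrite nnegrE !mulr_ge0 ?invr_ge0 ?(ltW d0) //; first lra.
  by rewrite subr_ge0 J_le.
rewrite [_ * (_ / d)]mulrA ler_pM2r ?invr_gt0 // -mulrA ler_pM2l //; lra.
Qed.

End Construction.

(** * From two-sided bounds to upper and lower limits *)

Lemma powR_asymptotic (R : realType) (a b c C e : R) :
  a < b -> 0 < c -> 0 < e ->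
  exists2 d : R, 0 < d < e & C * d `^ (- a) < c * d `^ (- b).
Proof.
move=> ab c0 e0; pose q := c / (`|C| + 1).
have q0 : 0 < q by rewrite divr_gt0 // ltr_wpDl.
have ba : 0 < b - a by rewrite subr_gt0.
(* Chosen so that [d ^ (b - a) <= q]; the [+ 1] in [q] keeps its denominator positive and makes the
   final inequality strict. *)
pose d := Num.min (e / 2) (q `^ (b - a)^-1).
have d0 : 0 < d by rewrite lt_min divr_gt0 // powR_gt0.
exists d; first by rewrite d0 gt_min; apply/orP; left; lra.
have -> : - a = (b - a) + - b by lra.
rewrite powRD; last by rewrite (gt_eqF d0) implybT.
rewrite mulrA ltr_pM2r ?powR_gt0 //.
have dq : d `^ (b - a) <= q.
  rewrite -[leRHS](powRr1 (ltW q0)) -(mulVf (lt0r_neq0 ba)) powRrM.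
  by apply: ge0_ler_powR; rewrite ?nnegrE ?powR_ge0 ?(ltW d0) ?(ltW ba) // ge_min lexx orbT.
apply: (@le_lt_trans _ _ (`|C| * d `^ (b - a))).
  by rewrite ler_wpM2r ?powR_ge0 // ler_norm.
apply: (@lt_le_trans _ _ ((`|C| + 1) * d `^ (b - a))).
  by rewrite ltr_pM2r ?powR_gt0 // ltrDl.
by rewrite mulrC -ler_pdivlMr // ltr_wpDl.
Qed.

(** Every right neighbourhood of [0] meets the interval [V] where the bounds hold, so suprema are at
    least [c] and infima at most [C]; the other two bounds come from [V] itself. *)
Lemma finite_positive_limf (R : realType) (f : R -> \bar R) (c C e : R) :
  0 < c -> 0 < e ->
  (forall d : R, 0 < d < e -> (c%:E <= f d)%E /\ (f d <= C%:E)%E) ->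
  finite_positive (limf_esup f 0^'+) /\ finite_positive (limf_einf f 0^'+).
Proof.
move=> c0 e0 fc; pose V : set R := [set d | 0 < d < e].
have FV : (0:R)^'+ V.
  near=> d; apply/andP; split; near: d; first exact: nbhs_right_gt.
  exact: nbhs_right_lt.
have meet (W : set R) : (0:R)^'+ W -> exists2 d, W d & V d.
  move=> FW; have [d [? ?]] := filter_ex (filterI FW FV).
  by exists d.
have supub W : (0:R)^'+ W -> (c%:E <= ereal_sup (f @` W))%E.
  move=> /meet [d Wd Vd]; apply: le_trans (fc d Vd).1 _.
  by apply: ereal_sup_ubound; exists d.
have infub W : (0:R)^'+ W -> (ereal_inf (f @` W) <= C%:E)%E.
  move=> /meet [d Wd Vd]; apply: le_trans (fc d Vd).2.
  by apply: ereal_inf_lbound; exists d.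
split; split.
- rewrite limf_esupE; apply: (@lt_le_trans _ _ c%:E); first by rewrite lte_fin.
  by apply: le_ereal_inf_tmp => _ [W FW <-]; exact: supub.
- apply: (@le_lt_trans _ _ C%:E); last exact: ltry.
  rewrite limf_esupE; apply: (@le_trans _ _ (ereal_sup (f @` V))).
    by apply: ereal_inf_lbound; exists V.
  by apply: ge_ereal_sup => _ [d Vd <-]; exact: (fc d Vd).2.
- rewrite limf_einfE; apply: (@lt_le_trans _ _ c%:E); first by rewrite lte_fin.
  apply: (@le_trans _ _ (ereal_inf (f @` V))).
    by apply: le_ereal_inf_tmp => _ [d Vd <-]; exact: (fc d Vd).1.
  by apply: ereal_sup_ubound; exists V.
- apply: (@le_lt_trans _ _ C%:E); last exact: ltry.
  by rewrite limf_einfE; apply: ge_ereal_sup => _ [W FW <-]; exact: infub.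
Unshelve. all: by end_near. Qed.

(** * The limits and the three dimensions *)

Section Estimates.
Variables (R : realType) (beta gamma : R).
Hypotheses (beta_gt0 : 0 < beta) (beta_lt_gamma : beta < gamma).
Hypothesis gamma_lt1 : gamma < 1.
Implicit Types (d l : R) (I L : set R).

Local Notation theta := (Defs.theta beta gamma).
Local Notation E := (Defs.E beta gamma).
Local Notation C0 := (local_const gamma).
Local Notation C1 := (global_const beta gamma).
Local Notation c0 := (lower_const beta gamma).

Lemma covering_number_local d l I : 0 < d -> d <= l -> itv_of_length l I ->
  (covering_number (E `&` I) d <= (C0 * (d / l) `^ (- gamma))%:E)%E.
Proof.
move=> d0 dl [a [b1 [b2 ->]]]; apply: covering_number_le.
have l0 : 0 < l by exact: lt_le_trans dl.
rewrite (_ : (d / l) `^ (- gamma) = (l / d) `^ gamma); last first.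
  have -> : l / d = (d / l) `^ (-1) by rewrite powR_inv1 ?invf_div // divr_ge0 ?ltW.
  by rewrite -powRrM mulN1r.
apply: (local_coverable beta_gt0 beta_lt_gamma gamma_lt1 d0 dl).
  exact: subIsetl.
move=> x y [_ /= xI] [_ /= yI].
have mem z : z \in Interval (BSide b1 a) (BSide b2 (a + l)) -> a <= z <= a + l.
  rewrite itv_boundlr => /andP[]; case: (b1); case: (b2);
  by rewrite !bnd_simp => z1 z2; rewrite ?z1 ?z2 ?(ltW z1) ?(ltW z2).
by move: (mem x xI) (mem y yI) => /andP[? ?] /andP[? ?]; lra.
Qed.

Lemma covering_number_global d : 0 < d -> d < 1 ->
  (covering_number E d <= (C1 * d `^ (- beta))%:E)%E.
Proof.
move=> d0 d1; apply: covering_number_le.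
exact: (E_coverable beta_gt0 beta_lt_gamma gamma_lt1).
Qed.

Lemma covering_number_lower d : 0 < d -> d < 1 ->
  ((c0 * d `^ (- beta))%:E <=
    covering_number (E `&` `[1%R, (1 + d `^ theta)%R]) d)%E.
Proof.
move=> d0 d1; apply: covering_number_ge => s.
exact: (covers_size_ge beta_gt0 beta_lt_gamma gamma_lt1).
Qed.

Lemma le_covering_number (A B : set R) d :
  A `<=` B -> (covering_number A d <= covering_number B d)%E.
Proof.
move=> AB; apply: ereal_inf_le_tmp => _ [n [c Bc] <-]; exists n => //.
by exists c; exact: subset_trans Bc.
Qed.

Lemma lt_powR_theta d : 0 < d -> d < 1 -> d < d `^ theta.
Proof.
move=> d0 d1; have tlt1 := theta_lt1 beta_gt0 beta_lt_gamma.
have -> : d `^ theta = d `^ 1 * (d `^ (1 - theta))^-1.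
  rewrite -powRN -powRD; last by rewrite (gt_eqF d0) implybT.
  by rewrite opprB addrC subrK.
rewrite powRr1 ?ltW // ltr_pMr // invf_gt1 ?powR_gt0 //.
have := @gt0_ltr_powR R (1 - theta) _ d 1; rewrite powR1 subr_gt0; apply=> //.
  by rewrite nnegrE ltW.
by rewrite nnegrE.
Qed.

(** Leaving the admissible lengths [L] abstract treats the spectrum and the Assouad counts together:
    [[1, 1 + d ^ theta]] gives the lower bound, and [d <= l] the upper one. *)
Lemma sup_local_count_finite_positive (L : R -> set R) :
  (forall d, 0 < d < 1 -> L d (d `^ theta)) ->
  (forall d l, 0 < d < 1 -> L d l -> d <= l) ->
  let f d := sup_local_count E gamma (L d) d in
  finite_positive (limf_esup f 0^'+) /\ finite_positive (limf_einf f 0^'+).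
Proof.
move=> Lth Lge f; apply: (@finite_positive_limf _ _ c0 C0 1) => //.
  exact: lower_const_gt0.
move=> d d01; have /andP[d0 d1] := d01; have th0 := powR_gt0 theta d0.
have powdl l : 0 < l -> (d / l) `^ gamma * (d / l) `^ (- gamma) = 1.
  by move=> l0; rewrite powRN divff // gt_eqF // powR_gt0 // divr_gt0.
split.
  have Ith : itv_of_length (d `^ theta) `[1%R, (1 + d `^ theta)%R].
    by exists 1, true, false.
  apply: (@le_trans _ _ (((d / d `^ theta) `^ gamma)%:E *
    covering_number (E `&` `[1%R, (1 + d `^ theta)%R]) d)%E).
    apply: (@le_trans _ _ (((d / d `^ theta) `^ gamma)%:E *
      (c0 * d `^ (- beta))%:E)%E); last first.
      by rewrite lee_wpmul2l ?lee_fin ?powR_ge0 // covering_number_lower.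
    rewrite -EFinM lee_fin -(powR_scaleE beta_gt0 beta_lt_gamma) //.
    rewrite mulrCA -powRM ?divr_ge0 ?(ltW d0) ?(ltW th0) //.
    by rewrite -[d / _]invf_div mulVf ?powR1 ?mulr1 // lt0r_neq0 // divr_gt0.
  apply: ereal_sup_ubound; exists (d `^ theta), `[1, 1 + d `^ theta]%classic.
  split=> //; first exact: Lth.
  have : d `^ theta <= 1.
    apply: powR_le1; last by rewrite !ltW.
    exact: ltW (theta_gt0 beta_gt0 beta_lt_gamma).
  by move=> ? x /=; rewrite !in_itv /= => /andP[? ?]; apply/andP; split; lra.
apply: ge_ereal_sup => _ [l [I [Ll II _ ->]]].
have dl := Lge d l d01 Ll.
have l0 : 0 < l by exact: lt_le_trans dl.
apply: (@le_trans _ _ (((d / l) `^ gamma)%:E * (C0 * (d / l) `^ (- gamma))%:E)%E).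
  by rewrite lee_wpmul2l ?lee_fin ?powR_ge0 // covering_number_local.
by rewrite -EFinM mulrCA powdl // mulr1.
Qed.

Lemma global_count_finite_positive :
  let f d := ((d `^ beta)%:E * covering_number E d)%E in
  finite_positive (limf_esup f 0^'+) /\ finite_positive (limf_einf f 0^'+).
Proof.
move=> f; apply: (@finite_positive_limf _ _ c0 C1 1) => //.
  exact: lower_const_gt0.
move=> d /andP[d0 d1].
have powd c : d `^ beta * (c * d `^ (- beta)) = c.
  by rewrite mulrCA powRN divff ?mulr1 // gt_eqF // powR_gt0.
rewrite /f -(powd c0) -(powd C1) !(EFinM (d `^ beta)).
split; apply: lee_wpmul2l; rewrite ?lee_fin ?powR_ge0 //.
  apply: le_trans (covering_number_lower d0 d1) _.
  by apply: le_covering_number; exact: subIsetl.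
exact: covering_number_global.
Qed.

Lemma Minkowski_dim : is_Minkowski_dim E beta.
Proof.
split=> [eps eps0|b /= Sb].
  exists C1 => d d0 d1; apply: le_trans (covering_number_global d0 d1) _.
  rewrite lee_fin ler_wpM2l //.
    by rewrite addr_ge0 ?mulr_ge0 // powR_ge0.
  by apply: ger_powR; rewrite ?d0 ?ltW //; lra.
rewrite leNgt; apply/negP => bb.
(* With half the difference as [eps], the exponent [b + eps] stays below [beta], so for small [d]
   the upper bound falls below the lower one. *)
have [|C SC] := Sb ((beta - b) / 2); first lra.
have [||d /andP[d0 d1]] :=
  @powR_asymptotic R (b + (beta - b) / 2) beta c0 C 1 _ _ ltr01.
- lra.
- exact: lower_const_gt0.
rewrite ltNge => /negP; apply; rewrite -lee_fin opprD.
apply: le_trans (SC d d0 d1); apply: le_trans (covering_number_lower d0 d1) _.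
by apply: le_covering_number; exact: subIsetl.
Qed.

Lemma local_bound_eps d l I eps : 0 < d -> d < l -> 0 < eps ->
  itv_of_length l I ->
  (covering_number (E `&` I) d <= (C0 * (d / l) `^ (- gamma - eps))%:E)%E.
Proof.
move=> d0 dl eps0 lI; apply: le_trans (covering_number_local d0 (ltW dl) lI) _.
have l0 : 0 < l by exact: lt_trans dl.
rewrite lee_fin ler_wpM2l //; first by rewrite addr_ge0 ?mulr_ge0 ?powR_ge0.
apply: ger_powR; last lra.
by rewrite divr_gt0 // ler_pdivrMr // mul1r ltW.
Qed.

Lemma Assouad_spectrum_dim : is_Assouad_spectrum theta E gamma.
Proof.
split=> [|g /= [d1 d10 Sg]].
  exists 1 => // eps eps0; exists C0 => d I d0 d1.
  by apply: local_bound_eps => //; exact: lt_powR_theta.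
rewrite leNgt; apply/negP => gg.
have [|C SC] := Sg ((gamma - g) / 2); first lra.
have th1 : 0 < 1 - theta by rewrite subr_gt0; exact: theta_lt1.
(* As [d / d ^ theta = d ^ (1 - theta)], all exponents carry the factor [1 - theta], and the
   comparison with [beta] reduces to one with [gamma]. *)
have betaE : beta = (1 - theta) * gamma.
  by rewrite /theta opprB addrC subrK divfK // gt_eqF // (lt_trans beta_gt0).
have [|||d /andP[d0 +]] := @powR_asymptotic R
  ((1 - theta) * (g + (gamma - g) / 2)) beta c0 C (Num.min d1 1).
- by rewrite [ltRHS]betaE ltr_pM2l //; lra.
- exact: lower_const_gt0.
- by rewrite lt_min d10 ltr01.
rewrite lt_min => /andP[dd1 dlt1].
rewrite ltNge => /negP; apply; rewrite -lee_fin.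
have Ith : itv_of_length (d `^ theta) `[1%R, (1 + d `^ theta)%R].
  by exists 1, true, false.
apply: le_trans (covering_number_lower d0 dlt1) _.
apply: le_trans (SC d _ d0 dd1 Ith) _; rewrite lee_fin le_eqVlt.
apply/orP; left; apply/eqP; congr (_ * _).
rewrite -{1}(powRr1 (ltW d0)) -powRB; last by rewrite (gt_eqF d0) implybT.
by rewrite -powRrM; congr (_ `^ _); rewrite -opprD mulrN.
Qed.

Lemma Assouad_dim : is_Assouad_dim E gamma.
Proof.
have th0 := theta_gt0 beta_gt0 beta_lt_gamma.
split=> [|g /= [d1 d10 Sg]].
  exists 1 => // eps eps0; exists C0 => d l I d0 _ dl _.
  exact: local_bound_eps.
(* An exponent valid for all lengths is valid for length [d ^ theta], so minimality is inherited
   from the spectrum. The threshold [d1 ^ (1 / theta)] ensures [d ^ theta < d1]. *)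
have [_ spectrum_min] := Assouad_spectrum_dim; apply: spectrum_min => /=.
exists (Num.min (Num.min d1 1) (d1 `^ theta^-1)).
  by rewrite !lt_min d10 ltr01 powR_gt0.
move=> eps /Sg [C SC]; exists C => d I d0.
rewrite !lt_min => /andP[/andP[dd1 dlt1] dth] lI.
apply: SC => //; first exact: lt_powR_theta.
have := gt0_ltr_powR th0 _ _ dth; rewrite -powRrM mulVf ?gt_eqF //.
by rewrite powRr1 ?(ltW d10) //; apply; rewrite nnegrE ?powR_ge0 // ltW.
Qed.

End Estimates.

Theorem lemma5p1 (R : realType) (beta gamma : R)
    (beta_gt0 : 0 < beta) (beta_lt_gamma : beta < gamma) (gamma_lt1 : gamma < 1) :
  let theta := theta beta gamma in
  let E := E beta gamma in
  let global_count := fun delta : R =>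
    ((delta `^ beta)%:E * covering_number E delta)%E in
  let spectrum_count := fun delta : R =>
    sup_local_count E gamma [set l | l = delta `^ theta] delta in
  let assouad_count := fun delta : R =>
    sup_local_count E gamma [set l | delta <= l] delta in
  E `<=` `[1, 2]%classic /\
  [/\ is_Assouad_dim E gamma,
      is_Assouad_spectrum theta E gamma &
      is_Minkowski_dim E beta] /\
  [/\ finite_positive (limf_esup global_count 0^'+),
      finite_positive (limf_einf global_count 0^'+) &
      finite_positive (limf_esup spectrum_count 0^'+)] /\
  [/\ finite_positive (limf_einf spectrum_count 0^'+),
      finite_positive (limf_esup assouad_count 0^'+) &
      finite_positive (limf_einf assouad_count 0^'+)].
Proof.
move=> theta E global_count spectrum_count assouad_count.
have [? ?] := global_count_finite_positive beta_gt0 beta_lt_gamma gamma_lt1.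
have d_lt_theta d (d01 : 0 < d < 1) : d <= d `^ theta.
  by have /andP[? ?] := d01; apply/ltW/lt_powR_theta.
have [||? ?] := @sup_local_count_finite_positive _ _ _ beta_gt0 beta_lt_gamma
  gamma_lt1 (fun d => [set l | l = d `^ theta]) => //.
  by move=> d l /= d01 ->; exact: d_lt_theta.
have [||? ?] := @sup_local_count_finite_positive _ _ _ beta_gt0 beta_lt_gamma
  gamma_lt1 (fun d => [set l | d <= l]) => //.
split; first exact: E_sub.
split; last by [].
split; [exact: Assouad_dim|exact: Assouad_spectrum_dim|exact: Minkowski_dim].
Qed.
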